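(* Let $\{p_n\}_{n\in\mathbb N}$ be a sequence of scalar polynomials with $\deg p_n=n$, let $\mathcal B_m(x)=[p_{mN}(x)\; p_{mN+1}(x)\;\cdots\;p_{(m+1)N-1}(x)]^T$, and let $\{V_m\}_{m\in\mathbb N}$ be the sequence of $N\times N$ matrix polynomials determined by $\mathcal B_m(x)=V_m(h(x))\mathcal P_0(x)$. Then the following statements are equivalent. (a) There are real numbers $c^{n+N-1}_{j}$ ($n\ge 0$, $n-N\le j\le n+N$) with $c^{n+N-1}_{n-N}\neq 0$ such that, for all $n\ge 0$, $$h(x)p_n(x)=c^{n+N-1}_{n+N}\,p_{n+N}(x)+\sum_{k=0}^{2N-1}c^{n+N-1}_{n+N-1-k}\,p_{n+N-1-k}(x).$$ (b) There are real numbers $c^{n+N-1}_j$ ($n\ge 0$, $n-N\le j\le n+N$) with $c^{n+N-1}_{n-N}\ne0$ such that $$h(x)\mathcal B_m(x)=A_m\mathcal B_{m+1}(x)+B_m\mathcal B_m(x)+C_m\mathcal B_{m-1}(x),\quad m\ge 1,$$ with initial conditions $\mathcal B_{-1}=0_{N\times 1}$ and $\mathcal B_0$ given. (c) There are real numbers $c^{n+N-1}_j$ ($n\ge 0$, $n-N\le j\le n+N$) with $c^{n+N-1}_{n-N}\ne0$ such that $$zV_m(z)=A_mV_{m+1}(z)+B_mV_m(z)+C_mV_{m-1}(z),\quad m\ge 1,$$ with initial conditions $V_{-1}=0_{N\times N}$ and $V_0$ a fixed matrix. Here the matrices $A_m$ (lower triangular), $B_m$ and $C_m$ (upper triangular)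 in the recurrence relations are given in terms of the numbers $c$ by $$A_m=\begin{bmatrix} c^{(m+1)N-1}_{(m+1)N}&\cdots&0\\ \vdots&\ddots&\vdots\\ c^{(m+2)N-2}_{(m+1)N}&\cdots&c^{(m+2)N-2}_{(m+2)N-1}\end{bmatrix},\quad B_m=\begin{bmatrix} c^{(m+1)N-1}_{mN}&\cdots&c^{(m+1)N-1}_{(m+1)N-1}\\ \vdots&\ddots&\vdots\\ c^{(m+2)N-2}_{mN}&\cdots&c^{(m+2)N-2}_{(m+1)N-1}\end{bmatrix},$$ $$C_m=\begin{bmatrix} c^{(m+1)N-1}_{(m-1)N}&\cdots&c^{(m+1)N-1}_{mN-1}\\ \vdots&\ddots&\vdots\\ 0&\cdots&c^{(m+2)N-2}_{mN-1}\end{bmatrix};$$ that is, for $i,j\in\{0,\dots,N-1\}$, $(A_m)_{ij}=c^{(m+1)N-1+i}_{(m+1)N+j}$ if $j\le i$ and $0$ otherwise, $(B_m)_{ij}=c^{(m+1)N-1+i}_{mN+j}$, and $(C_m)_{ij}=c^{(m+1)N-1+i}_{(m-1)N+j}$ if $j\ge i$ and $0$ otherwise.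
   Context: $N\ge1$ is a fixed integer, $\mathbb N=\{0,1,2,\dots\}$, and $h$ is a fixed real polynomial with $\deg h=N$. Scalar polynomials have real coefficients, and $p_j=0$ for $j<0$. $\mathcal P_0(x)=[1\; x\;\cdots\;x^{N-1}]^T$. Since $\{x^jh(x)^i: 0\le j\le N-1,\ i\ge0\}$ is a basis of the space of polynomials, each $\mathcal B_m$ can be written uniquely as $\mathcal B_m(x)=V_m(h(x))\mathcal P_0(x)$ with $V_m$ an $N\times N$ matrix polynomial (of degree $m$) with real matrix coefficients. *)

(* Defs.v *)
From HB Require Import structures.
From mathcomp Require Import all_boot all_order all_algebra.
From mathcomp Require Import reals.
Set Implicit Arguments.
Unset Strict Implicit.
Unset Printing Implicit Defensive.
Import GRing.Theory.
Local Open Scope ring_scope.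

(* Real numbers: an arbitrary [R : realType].  Scalar polynomials are
   formal ones; since R is infinite, their identities are the identities
   between polynomial functions, for all values of the variable.  N x N matrix
   polynomials are matrices with entries in {poly R}. *)

(* The convention u_j = 0 for j < 0. *)
Definition zext (V : nmodType) (u : nat -> V) (j : int) : V :=
  if j is Posz n then u n else 0.

Definition calP0 (R : realType) (N : nat) : 'cV[{poly R}]_N :=
  \col_(j < N) 'X^j.

(* Defined for every integer m, so that the index -1 is meaningful. *)
Definition calB (R : realType) (N : nat) (p : nat -> {poly R}) (m : int) :
    'cV[{poly R}]_N :=
  \col_(i < N) zext p (m * N%:Z + i%:Z).

(* W(z) |-> W(h(x)), entrywise. *)
Definition mxcomp (R : realType) (N : nat) (W : 'M[{poly R}]_N)
    (h : {poly R}) : 'M[{poly R}]_N :=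
  map_mx (fun q => q \Po h) W.

(* A real matrix seen as a constant matrix polynomial. *)
Definition mxC (R : realType) (N : nat) (M : 'M[R]_N) : 'M[{poly R}]_N :=
  map_mx polyC M.

(* [c u l] is the number with upper index u and lower index l.  The upper
   index is n + N - 1 with n >= 0 and N >= 1, so the truncated subtraction of
   nat is exact; the lower index may be negative.  Only the values with
   u = n + N - 1 and n - N <= l <= n + N are ever used. *)
Definition matA (R : realType) (N : nat) (c : nat -> int -> R) (m : nat) :
    'M[R]_N :=
  \matrix_(i < N, j < N)
    if (j <= i)%N
    then c ((m + 1) * N - 1 + i)%N ((m%:Z + 1) * N%:Z + j%:Z) else 0.

Definition matB (R : realType) (N : nat) (c : nat -> int -> R) (m : nat) :
    'M[R]_N :=
  \matrix_(i < N, j < N)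
    c ((m + 1) * N - 1 + i)%N (m%:Z * N%:Z + j%:Z).

Definition matC (R : realType) (N : nat) (c : nat -> int -> R) (m : nat) :
    'M[R]_N :=
  \matrix_(i < N, j < N)
    if (i <= j)%N
    then c ((m + 1) * N - 1 + i)%N ((m%:Z - 1) * N%:Z + j%:Z) else 0.

(* Main.v *)
Require Import Defs.
From HB Require Import structures.
From mathcomp Require Import all_boot all_order all_algebra.
From mathcomp Require Import reals zify.
Set Implicit Arguments.
Unset Strict Implicit.
Unset Printing Implicit Defensive.
Import GRing.Theory.
Local Open Scope ring_scope.

(** The vector relation (b) at [m], read entry by entry, is the scalar relation
    (a) for the [N] consecutive indices [n = m N, ..., m N + N - 1]: the
    triangular shapes of the outer two matrices cut the three blocks of [p]
    down to the window from [n - N] to [n + N]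
    ([sum_window_blocks], [block_recurrence_rows]).  Since [h(x)] times a
    matrix polynomial in [h(x)] is again one, and since the representation
    [W(h(x)) P_0(x)] determines [W] ([mxcomp_calP0_inj]), the relation (c) at
    [m] is equivalent to (b) at [m] with the same coefficients
    ([matrix_recurrence_block]); that [V_0] is constant only says that
    [p_0, ..., p_(N-1)] have degree less than [N].

    What (b) and (c) leave out are the indices [n < N] of (a), as [m = 0] is
    excluded there.  For these the scalar relation carries no information:
    [h p_n] has degree [n + N], so it expands in [p_0, ..., p_(n+N)], which all
    lie in the window, while the coefficient at [n - N < 0], required to be
    nonzero, multiplies the zero polynomial and can be taken to be 1
    ([scalar_recurrence_low]).  So the equivalence closes after the first [N]
    rows of the coefficient array have been replaced. *)

(** * Expansions of polynomials *)

(** Writing [q j = q1 j * 'X + (constant)], the sum becomes [h] times the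
    corresponding sum for [q1] plus a polynomial of degree less than [N]. As
    [h] has degree [N], both parts vanish, and induction on the degrees
    applies to [q1]. *)
Lemma hadic_expansion_eq0 (F : idomainType) (N : nat) (h : {poly F})
    (size_h : size h = N.+1) (q : 'I_N -> {poly F}) :
  \sum_j (q j \Po h) * 'X^j = 0 -> forall j, q j = 0.
Proof.
have [b] : exists b, forall j, (size (q j) <= b)%N.
  by exists (\max_j size (q j)) => j; exact: leq_bigmax.
elim: b q => [|b IHb] q size_q sum_q0 j.
  by apply/eqP; rewrite -size_poly_leq0.
pose q1 j := drop_poly 1 (q j).
have qE i : q i = q1 i * 'X + ((q i)`_0)%:P.
  rewrite -{1}(poly_take_drop 1 (q i)) addrC expr1; congr (_ + _).
  by apply/polyP => k; rewrite coef_take_poly coefC; case: k.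
pose low := \poly_(i < N) (if insub i is Some k then (q k)`_0 else 0).
have lowE : low = \sum_j (q j)`_0 *: 'X^j.
  rewrite /low poly_def; apply: eq_bigr => i _.
  by rewrite insubT //= => ltiN; congr ((q _)`_0 *: _); exact: val_inj.
pose S := \sum_j (q1 j \Po h) * 'X^j.
have sumE : S * h + low = 0.
  rewrite -sum_q0 lowE mulr_suml -big_split; apply: eq_bigr => i _ /=.
  rewrite [in RHS]qE comp_polyD comp_polyM comp_polyX comp_polyC mulrDl.
  by rewrite mul_polyC mulrAC.
have S0 : S = 0.
  apply/eqP/negP => /negP S_neq0.
  have h_neq0 : h != 0 by rewrite -size_poly_eq0 size_h.
  have : (size (S * h)%R <= N)%N.
    have -> : S * h = - low by apply/eqP; rewrite -addr_eq0 sumE.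
    by rewrite size_polyN size_poly.
  have := S_neq0; rewrite size_mul // -size_poly_gt0 size_h; lia.
have q1_0 i : q1 i = 0.
  apply: IHb S0 i => i; rewrite size_drop_poly; have := size_q i; lia.
have low0 : low = 0 by move: sumE; rewrite S0 mul0r add0r.
rewrite qE q1_0 mul0r add0r; move/polyP/(_ j): low0.
by rewrite coef_poly ltn_ord valK coef0 => ->.
Qed.

Lemma poly_graded_span (F : fieldType) (p : nat -> {poly F}) :
  (forall n, size (p n) = n.+1) ->
  forall (n : nat) (q : {poly F}), (size q <= n)%N ->
  exists a : nat -> F, q = \sum_(0 <= k < n) a k *: p k.
Proof.
move=> size_p; elim=> [|n IHn] q size_q.
  exists (fun=> 0); rewrite big_geq //.
  by apply/eqP; rewrite -size_poly_leq0.
pose t := q`_n / lead_coef (p n).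
have [|a aE] := IHn (q - t *: p n).
  apply/leq_sizeP => j; rewrite leq_eqVlt => /predU1P[<-|ltnj].
    rewrite coefB coefZ /t lead_coefE size_p divfK ?subrr //.
    have -> : (p n)`_n = lead_coef (p n) by rewrite lead_coefE size_p.
    by rewrite lead_coef_eq0 -size_poly_eq0 size_p.
  rewrite coefB coefZ !nth_default ?mulr0 ?subrr ?size_p //.
  exact: leq_trans size_q ltnj.
exists (fun k => if (k < n)%N then a k else t).
rewrite big_nat_recr //= ltnn -[LHS](subrK (t *: p n)) aE; congr (_ + _).
by apply: eq_big_nat => k /andP[_ ->].
Qed.

(** * Rearranging the window of summation *)

Lemma sum_window_rev (V : nmodType) (f : int -> V) (n N : nat) :
  f (n%:Z + N%:Z) + \sum_(0 <= k < 2 * N) f (n%:Z + N%:Z - 1 - k%:Z) =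
  \sum_(0 <= k < (2 * N).+1) f (n%:Z - N%:Z + k%:Z).
Proof.
rewrite big_nat_recr //= addrC big_nat_rev /=; congr (_ + f _); last lia.
by apply: eq_big_nat => k /andP[_ ltk]; congr f; lia.
Qed.

(** Positions [0, ..., 3N - 1] form the three blocks; the conditions on [j] in
    the outer blocks keep exactly the positions from [i] to [i + 2N]. *)
Lemma sum_window_blocks (V : nmodType) (g : nat -> V) (i N : nat) :
  (i < N)%N ->
  \sum_(j < N) (if (j <= i)%N then g (N + N + j)%N else 0)
  + \sum_(j < N) g (N + j)%N
  + \sum_(j < N) (if (i <= j)%N then g j else 0)
  = \sum_(0 <= k < (2 * N).+1) g (i + k)%N.
Proof.
move=> ltiN.
have -> : \sum_(0 <= k < (2 * N).+1) g (i + k)%N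
    = \sum_(i <= k < N + N + i.+1) g k.
  rewrite -{2}[i]add0n big_addn.
  have -> : (N + N + i.+1 - i = (2 * N).+1)%N by lia.
  by apply: eq_bigr => k _; rewrite addnC.
rewrite (@big_cat_nat _ _ _ N) //=; [|lia|lia].
rewrite (@big_cat_nat _ _ _ (N + N) N) //=; [|lia|lia].
rewrite [LHS]addrC; congr (_ + _).
  rewrite -big_mkcond /= -(big_mkord (fun j => (i <= j)%N) g).
  by rewrite [RHS](big_nat_widenl i 0).
rewrite [LHS]addrC; congr (_ + _).
  rewrite -[X in \sum_(X <= _ < _) _]add0n big_addn addnK big_mkord.
  by apply: eq_bigr => j _; rewrite addnC.
rewrite -big_mkcond /= -{2}[(N + N)%N]add0n big_addn addKn big_mkord.
rewrite (big_ord_widen N (fun j => g (j + (N + N))%N)) //.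
by apply: eq_bigr => j _; rewrite addnC.
Qed.

(** * Substituting h into matrix polynomials *)

Lemma mxcompD (R : realType) (N : nat) (h : {poly R})
    (W1 W2 : 'M[{poly R}]_N) :
  mxcomp (W1 + W2) h = mxcomp W1 h + mxcomp W2 h.
Proof. exact: raddfD. Qed.

Lemma mxcomp_mulC (R : realType) (N : nat) (h : {poly R})
    (M : 'M[R]_N) (W : 'M[{poly R}]_N) :
  mxcomp (mxC M *m W) h = mxC M *m mxcomp W h.
Proof.
rewrite /mxcomp map_mxM; congr (_ *m _).
by apply/matrixP => i j; rewrite !mxE /= comp_polyC.
Qed.

Lemma mxcompZX (R : realType) (N : nat) (h : {poly R}) (W : 'M[{poly R}]_N) :
  mxcomp ('X *: W) h = h *: mxcomp W h.
Proof. by apply/matrixP => i j; rewrite !mxE comp_polyM comp_polyX. Qed.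

Lemma mxcomp_calP0_inj (R : realType) (N : nat) (h : {poly R})
    (size_h : size h = N.+1) (W1 W2 : 'M[{poly R}]_N) :
  mxcomp W1 h *m calP0 R N = mxcomp W2 h *m calP0 R N -> W1 = W2.
Proof.
move=> eqW; apply/matrixP => i j; apply/eqP; rewrite -subr_eq0; apply/eqP.
apply: (hadic_expansion_eq0 size_h (q := fun j => W1 i j - W2 i j)).
under eq_bigr do rewrite comp_polyB mulrBl.
move/colP/(_ i): eqW; rewrite !mxE => /eqP.
rewrite -subr_eq0 -sumrB => /eqP eqW; rewrite -[RHS]eqW.
by apply: eq_bigr => k _; rewrite !mxE.
Qed.

(** * The three recurrence relations *)

(** Here [a] is the row [c (n + N - 1)] of the coefficient array, so that the
    relation for one [n] can be met by choosing that row alone. *)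
Definition scalar_recurrence (R : realType) (N : nat) (h : {poly R})
    (p : nat -> {poly R}) (a : int -> R) (n : nat) :=
  h * p n =
    a (n%:Z + N%:Z) *: zext p (n%:Z + N%:Z)
    + \sum_(0 <= k < 2 * N)
        a (n%:Z + N%:Z - 1 - k%:Z) *: zext p (n%:Z + N%:Z - 1 - k%:Z).

Definition block_recurrence (R : realType) (N : nat) (h : {poly R})
    (p : nat -> {poly R}) (c : nat -> int -> R) (m : nat) :=
  h *: calB N p m%:Z =
    mxC (matA N c m) *m calB N p (m%:Z + 1)
    + mxC (matB N c m) *m calB N p m%:Z
    + mxC (matC N c m) *m calB N p (m%:Z - 1).

Definition matrix_recurrence (R : realType) (N : nat)
    (V : nat -> 'M[{poly R}]_N) (c : nat -> int -> R) (m : nat) :=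
  'X *: zext V m%:Z =
    mxC (matA N c m) *m zext V (m%:Z + 1)
    + mxC (matB N c m) *m zext V m%:Z
    + mxC (matC N c m) *m zext V (m%:Z - 1).

Section Recurrences.
Variables (R : realType) (N : nat) (h : {poly R}) (p : nat -> {poly R}).

(** The row with upper index [(m + 1) N - 1 + i] of the coefficient array is the
    one attached to [n = m N + i], and the blocks [m - 1], [m], [m + 1] of [p]
    start at the index [(m - 1) N = (n - N) - i]. *)
Lemma block_recurrence_rows (c : nat -> int -> R) (m : nat) :
  block_recurrence N h p c m <->
  forall i : 'I_N,
    scalar_recurrence N h p (c (m * N + i + N - 1)%N) (m * N + i).
Proof.
pose rhs := mxC (matA N c m) *m calB N p (m%:Z + 1)
    + mxC (matB N c m) *m calB N p m%:Z
    + mxC (matC N c m) *m calB N p (m%:Z - 1).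
have rowE (i : 'I_N) :
    scalar_recurrence N h p (c (m * N + i + N - 1)%N) (m * N + i) <->
    (h *: calB N p m%:Z) i 0 = rhs i 0.
  have lhsE : (h *: calB N p m%:Z) i 0 = h * p (m * N + i)%N.
    by rewrite !mxE /zext -PoszM.
  have ltiN := ltn_ord i.
  pose f l := c (m * N + i + N - 1)%N l *: zext p l.
  suff rhsE : rhs i 0 = f ((m * N + i)%N%:Z + N%:Z)
     + \sum_(0 <= k < 2 * N) f ((m * N + i)%N%:Z + N%:Z - 1 - k%:Z).
    by rewrite lhsE rhsE.
  rewrite sum_window_rev.
  pose g k := f ((m%:Z - 1) * N%:Z + k%:Z).
  transitivity (\sum_(0 <= k < (2 * N).+1) g (i + k)%N); last first.
    by apply: eq_bigr => k _; congr f; lia.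
  have uE : ((m + 1) * N - 1 + i = m * N + i + N - 1)%N by lia.
  rewrite -sum_window_blocks // !mxE; congr (_ + _ + _).
  - apply: eq_bigr => j _; rewrite !mxE uE; case: ifP => _.
      by rewrite mul_polyC /g /f; congr (c _ _ *: zext p _); lia.
    by rewrite polyC0 mul0r.
  - apply: eq_bigr => j _; rewrite !mxE uE.
    by rewrite mul_polyC /g /f; congr (c _ _ *: zext p _); lia.
  - apply: eq_bigr => j _; rewrite !mxE uE; case: ifP => _.
      by rewrite mul_polyC.
    by rewrite polyC0 mul0r.
rewrite /block_recurrence -/rhs; split=> [eqm i|eqs].
  by apply/rowE; rewrite eqm.
by apply/colP => i; apply/rowE.
Qed.

Lemma calB_neg (m : nat) : calB N p (Negz m) = 0.
Proof.
apply/colP => i; rewrite !mxE; have ltiN := ltn_ord i.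
by case E: (Negz m * N%:Z + i%:Z) => [k|k] //; exfalso; nia.
Qed.

Hypothesis size_h : size h = N.+1.

Variable V : nat -> 'M[{poly R}]_N.
Hypothesis calBE : forall m : nat, calB N p m%:Z = mxcomp (V m) h *m calP0 R N.

(** Both sides vanish at negative [m], so the relations at [m - 1] need no
    separate treatment of the index -1. *)
Lemma calB_zext (m : int) : calB N p m = mxcomp (zext V m) h *m calP0 R N.
Proof.
case: m => m; rewrite ?calBE // calB_neg /zext /mxcomp.
by rewrite raddf0 mul0mx.
Qed.

Lemma matrix_recurrence_block (c : nat -> int -> R) (m : nat) :
  matrix_recurrence V c m <-> block_recurrence N h p c m.
Proof.
rewrite /matrix_recurrence /block_recurrence !calB_zext !mulmxA scalemxAl.
rewrite -!mxcomp_mulC -mxcompZX -!mulmxDl -!mxcompD.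
by split=> [->|/(mxcomp_calP0_inj size_h)].
Qed.

(** The candidate is the coefficient matrix of [p_0, ..., p_(N-1)], whose
    degrees are less than [N]. *)
Lemma V0_const : (forall n, size (p n) = n.+1) ->
  exists M : 'M[R]_N, V 0%N = mxC M.
Proof.
move=> size_p; exists (\matrix_(i, j) (p i)`_j).
apply: (mxcomp_calP0_inj size_h); rewrite -calBE; apply/colP => i; rewrite !mxE.
rewrite mul0r add0r /= -[p i in LHS]coefK poly_def.
rewrite size_p (big_ord_widen N (fun k => (p i)`_k *: 'X^k)) //.
rewrite big_mkcond; apply: eq_bigr => j _; rewrite !mxE comp_polyC mul_polyC.
case: ifP => // /negbT; rewrite -leqNgt => ltij.
by rewrite nth_default ?scale0r // size_p.
Qed.

(** For [n < N] the relation is an expansion in the basis [p]: the window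
    contains all of [p_0, ..., p_(n+N)], and its entries at negative indices are
    free because [p] vanishes there. *)
Lemma scalar_recurrence_low (n : nat) : (forall n, size (p n) = n.+1) ->
  (n < N)%N ->
  exists2 a : int -> R, a (n%:Z - N%:Z) != 0 & scalar_recurrence N h p a n.
Proof.
move=> size_p ltnN.
have [|a hpE] := poly_graded_span size_p (n := (n + N).+1) (q := h * p n).
  by apply: leq_trans (size_polyMleq _ _) _; rewrite size_h size_p; lia.
pose b (l : int) : R := if l is Posz k then a k else 1.
exists b.
  rewrite /b; case E: (n%:Z - N%:Z) => [k|k]; first by exfalso; lia.
  exact: oner_neq0.
rewrite /scalar_recurrence (sum_window_rev (fun l => b l *: zext p l)) hpE.
rewrite [RHS](@big_cat_nat _ _ _ (N - n)) //=; [|lia].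
(* The first N - n terms of the window carry negative indices. *)
rewrite [X in _ = X + _]big_nat_cond [X in _ = X + _]big1 ?add0r => [|k].
  rewrite -{1}[(N - n)%N]add0n big_addn.
  have -> : ((2 * N).+1 - (N - n) = (n + N).+1)%N by lia.
  apply: eq_bigr => k _.
  by have -> : n%:Z - N%:Z + (k + (N - n))%N%:Z = k%:Z by lia.
rewrite andbT => ltk.
by case E: (n%:Z - N%:Z + k%:Z) => [l|l]; [exfalso; lia | rewrite scaler0].
Qed.

End Recurrences.

(** * The equivalence *)

Theorem theorem2 (R : realType) (N : nat) (hN : (1 <= N)%N)
  (h : {poly R}) (deg_h : size h = N.+1)
  (p : nat -> {poly R}) (deg_p : forall n : nat, size (p n) = n.+1)
  (V : nat -> 'M[{poly R}]_N)
  (hV : forall m : nat, calB N p m%:Z = mxcomp (V m) h *m calP0 R N) :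
  [<->
    (* (a) *)
    exists c : nat -> int -> R,
      (forall n : nat, c (n + N - 1)%N (n%:Z - N%:Z) != 0) /\
      (forall n : nat,
        h * p n =
          c (n + N - 1)%N (n%:Z + N%:Z) *: zext p (n%:Z + N%:Z)
          + \sum_(0 <= k < 2 * N)
              c (n + N - 1)%N (n%:Z + N%:Z - 1 - k%:Z)
                *: zext p (n%:Z + N%:Z - 1 - k%:Z));
    (* (b) *)
    exists c : nat -> int -> R,
      [/\ forall n : nat, c (n + N - 1)%N (n%:Z - N%:Z) != 0,
          forall m : nat, (1 <= m)%N ->
            h *: calB N p m%:Z =
              mxC (matA N c m) *m calB N p (m%:Z + 1)
              + mxC (matB N c m) *m calB N p m%:Z
              + mxC (matC N c m) *m calB N p (m%:Z - 1)
        & calB N p (-1) = 0];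
    (* (c) *)
    exists c : nat -> int -> R,
      [/\ forall n : nat, c (n + N - 1)%N (n%:Z - N%:Z) != 0,
          forall m : nat, (1 <= m)%N ->
            'X *: zext V m%:Z =
              mxC (matA N c m) *m zext V (m%:Z + 1)
              + mxC (matB N c m) *m zext V m%:Z
              + mxC (matC N c m) *m zext V (m%:Z - 1),
          zext V (-1) = 0
        & exists M : 'M[R]_N, V 0%N = mxC M]].
Proof.
have blockP c : (forall m, (1 <= m)%N -> block_recurrence N h p c m) <->
    (forall n, (N <= n)%N -> scalar_recurrence N h p (c (n + N - 1)%N) n).
  split=> [rec_c n leNn | rec_c m lt0m].
    have mod_lt : (n %% N < N)%N by rewrite ltn_mod.
    have /rec_c/block_recurrence_rows/(_ (Ordinal mod_lt)) :
      (1 <= n %/ N)%N by rewrite divn_gt0.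
    by rewrite /= -divn_eq.
  by apply/block_recurrence_rows => i; apply: rec_c; nia.
have calB_m1 : calB N p (-1) = 0 by exact: (calB_neg N p 0).
tfae.
- case=> c [c_neq0 rec_c]; exists c; split=> //.
  by apply/blockP => n _; exact: rec_c.
- case=> c [c_neq0 rec_c _]; exists c; split=> //.
    by move=> m lt0m; apply/(matrix_recurrence_block deg_h hV); exact: rec_c.
  exact: (V0_const deg_h hV deg_p).
- case=> c [c_neq0 rec_c _ _].
  have {}rec_c : forall n, (N <= n)%N ->
      scalar_recurrence N h p (c (n + N - 1)%N) n.
    apply/blockP => m lt0m.
    by apply/(matrix_recurrence_block deg_h hV); exact: rec_c.
  pose low := scalar_recurrence_low deg_h deg_p.
  have /fin_all_exists2 [a a_neq0 rec_a] := fun n : 'I_N => low n (ltn_ord n).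
  (* The rows of c that belong to n < N are replaced; u = n + N - 1 is solved
     for n. *)
  pose c' u l := if insub (u + 1 - N)%N is Some n then a n l else c u l.
  have c'E n : c' (n + N - 1)%N =
      if insub n is Some i then a i else c (n + N - 1)%N.
    rewrite /c'; have -> : (n + N - 1 + 1 - N = n)%N by lia.
    by case: insub.
  exists c'; split=> n; rewrite !c'E; case: insubP => [i _ <-|] //.
  + exact: rec_a.
  + by rewrite -leqNgt; exact: rec_c.
Qed.
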